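(* Let $Z=\{Z_t\}_{t=0,1,2,\dots}$ be a Parisian walk with local time $\{L_t\}$, and set $$\varphi_t := 1_{\{Z_t\in\bar A_1\}}+\zeta 1_{\{Z_t\in\bar A_3\}}+\zeta^2 1_{\{Z_t\in\bar A_5\}},\qquad \psi_t := 1_{\{Z_t\in A_6\}}+\zeta 1_{\{Z_t\in A_4\}}+\zeta^2 1_{\{Z_t\in A_2\}}.$$ Then for every $t=0,1,2,\dots$, $$\Vert Z_{t+1}\Vert-\Vert Z_t\Vert=\frac23\,\mathrm{Re}\Big((1-\zeta^2)\big(\varphi_t\,(Z_{t+1}-Z_t)+\psi_t\,(\bar Z_{t+1}-\bar Z_t)\big)\Big)+L_{t+1}-L_t .$$
   Context: Let $\zeta=(-1+\sqrt{-3})/2$ and $\mathbb{Z}[\zeta]=\{a+b\zeta : a,b\in\mathbb{Z}\}\subset\mathbb{C}$. Let $\tau_1,\tau_2,\dots$ be an i.i.d. sequence with $\mathsf{P}(\tau_i=1)=\mathsf{P}(\tau_i=\zeta)=\mathsf{P}(\tau_i=\zeta^2)=1/3$, and let $\mathbf{F}=\{\mathcal{F}_t\}_{t\ge 0}$ be the filtration it generates: $\mathcal{F}_t=\sigma(\tau_1,\dots,\tau_t)$, with $\mathcal{F}_0$ trivial. Parisian walk: an $\mathbf{F}$-adapted complex valued process $\{Z_t\}_{t\ge 0}$ such that (i) it is an $\mathbf{F}$-martingale starting from a point of $\mathbb{Z}[\zeta]$, and (ii) $Z_{t+1}-Z_t\in\{1,\zeta,\zeta^2\}$ for all $t$. $\bar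 Z_t$ denotes the complex conjugate of $Z_t$. Graph distance: $\mathbb{Z}[\zeta]$ is regarded as the (undirected) triangular lattice graph in which $z$ and $w$ are adjacent iff $z-w\in\{\pm1,\pm\zeta,\pm\zeta^2\}$. Let $P=\{0,1,1+\zeta\}$. For $z\in\mathbb{Z}[\zeta]$, $\Vert z\Vert$ is the length of the shortest path from $P$ to $z$ in this graph (so $\Vert z\Vert=0$ for $z\in P$). Regions ($k_1,k_2$ range over integers): $A_1=\{k_1+k_2\zeta^2 : 1<k_2+1<k_1\}$, $A_2=\{-k_1\zeta-k_2 : 0\le k_2<k_1\}$, $A_3=\{-k_1-k_2\zeta : 0<k_2<k_1\}$, $A_4=\{k_1\zeta+k_2\zeta^2 : 0\le k_2<k_1\}$, $A_5=\{-k_1\zeta^2-k_2 : 1<k_2+1<k_1\}$, $A_6=\{k_1+k_2\zeta : 0<k_2<k_1\}$; $B_1=\{k : k\ge 2\}$, $B_2=\{k\zeta-\zeta^2 : k\ge1\}$, $B_3=\{k\zeta^2 : k\ge 1\}$, $B_4=\{k : k\le -1\}$, $B_5=\{1+k\zeta : k\le -1\}$, $B_6=\{k\zeta^2 : k\le -2\}$ (with $k$ an integer). Closures (notation only, not complex conjugates): $\bar A_1=A_1\cup B_1\cup B_5\cup\{1\}$, $\bar A_3=A_3\cup B_3\cup B_4\cup\{0\}$, $\bar A_5=A_5\cup B_2\cup B_6\cup\{1+\zeta\}$. Local time: for $j=1,3,5$ let $l^j_t=\#\{u\in\mathbb{Z}_{\ge0} : u<t,\ Z_u\in\bar A_j,\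 Z_{u+1}\notin\bar A_j\}$, and $L_t=l^1_t+l^3_t+l^5_t$. *)

(* Defs.v *)
From HB Require Import structures.
From mathcomp Require Import all_boot all_order all_algebra.
From mathcomp Require Import all_classical all_reals all_analysis.
From mathcomp Require Import complex.

Set Implicit Arguments.
Unset Strict Implicit.
Unset Printing Implicit Defensive.

Import Order.TTheory GRing.Theory Num.Theory numFieldNormedType.Exports.

Local Open Scope classical_set_scope.
Local Open Scope ring_scope.

Definition zeta {R : realType} : R[i] := (- 1 +i* Num.sqrt 3)%C / 2.

Definition eisenstein {R : realType} : set R[i] :=
  [set z | exists a b : int, z = a%:~R + b%:~R * zeta].

(* Two points of R[i] related by tri_adj are both in Z[zeta] as soon as one of
   them is, so that the paths starting in Z[zeta] are exactly the paths of the
   triangular lattice. *)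
Definition tri_adj {R : realType} : rel R[i] := fun z w =>
  z - w \in [:: 1; - 1; zeta; - zeta; zeta ^+ 2; - zeta ^+ 2].

Definition path_lengths {R : realType} (z : R[i]) : set nat :=
  [set n | exists x p, [/\ x \in [:: 0; 1; 1 + zeta],
     path tri_adj x p, last x p = z & size p = n]].

(* Outside Z[zeta] there is no path from {0, 1, 1 + zeta} to z, and the value
   is 0. *)
Definition tri_norm {R : realType} (z : R[i]) : nat :=
  xget 0%N [set n | path_lengths z n /\
                    forall m, path_lengths z m -> (n <= m)%N].

Definition A1 {R : realType} : set R[i] := [set z | exists k1 k2 : int,
  1 < k2 + 1 < k1 /\ z = k1%:~R + k2%:~R * zeta ^+ 2].
Definition A2 {R : realType} : set R[i] := [set z | exists k1 k2 : int,
  0 <= k2 < k1 /\ z = - k1%:~R * zeta - k2%:~R].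
Definition A3 {R : realType} : set R[i] := [set z | exists k1 k2 : int,
  0 < k2 < k1 /\ z = - k1%:~R - k2%:~R * zeta].
Definition A4 {R : realType} : set R[i] := [set z | exists k1 k2 : int,
  0 <= k2 < k1 /\ z = k1%:~R * zeta + k2%:~R * zeta ^+ 2].
Definition A5 {R : realType} : set R[i] := [set z | exists k1 k2 : int,
  1 < k2 + 1 < k1 /\ z = - k1%:~R * zeta ^+ 2 - k2%:~R].
Definition A6 {R : realType} : set R[i] := [set z | exists k1 k2 : int,
  0 < k2 < k1 /\ z = k1%:~R + k2%:~R * zeta].

Definition B1 {R : realType} : set R[i] :=
  [set z | exists k : int, 2 <= k /\ z = k%:~R].
Definition B2 {R : realType} : set R[i] :=
  [set z | exists k : int, 1 <= k /\ z = k%:~R * zeta - zeta ^+ 2].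
Definition B3 {R : realType} : set R[i] :=
  [set z | exists k : int, 1 <= k /\ z = k%:~R * zeta ^+ 2].
Definition B4 {R : realType} : set R[i] :=
  [set z | exists k : int, k <= - 1 /\ z = k%:~R].
Definition B5 {R : realType} : set R[i] :=
  [set z | exists k : int, k <= - 1 /\ z = 1 + k%:~R * zeta].
Definition B6 {R : realType} : set R[i] :=
  [set z | exists k : int, k <= - 2 /\ z = k%:~R * zeta ^+ 2].

Definition clA1 {R : realType} : set R[i] := A1 `|` B1 `|` B5 `|` [set 1].
Definition clA3 {R : realType} : set R[i] := A3 `|` B3 `|` B4 `|` [set 0].
Definition clA5 {R : realType} : set R[i] :=
  A5 `|` B2 `|` B6 `|` [set 1 + zeta].

Definition exits {R : realType} (A : set R[i]) (x : nat -> R[i]) (t : nat) :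
    nat :=
  #|[pred u : 'I_t | (x u \in A) && (x u.+1 \notin A)]|.

Definition local_time {R : realType} (x : nat -> R[i]) (t : nat) : nat :=
  (exits clA1 x t + exits clA3 x t + exits clA5 x t)%N.

Definition phi {R : realType} (z : R[i]) : R[i] :=
  \1_clA1 z + zeta * \1_clA3 z + zeta ^+ 2 * \1_clA5 z.

Definition psi {R : realType} (z : R[i]) : R[i] :=
  \1_A6 z + zeta * \1_A4 z + zeta ^+ 2 * \1_A2 z.

(* R[i]^o is R[i] with its norm topology. *)
Definition borelC {R : realType} : set (set R[i]) := <<s @open R[i]^o >>.

(* The sequence tau_1, tau_2, ... is indexed from 0: tau i stands for
   tau_(i+1). *)
Definition iid_cube_roots {R : realType} {d : measure_display}
    {T : measurableType d} (P : probability T R) (tau : nat -> T -> R[i]) :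
    Prop :=
  [/\ forall i B, borelC B -> measurable (tau i @^-1` B),
      forall i x, x \in [:: 1; zeta; zeta ^+ 2] ->
        P (tau i @^-1` [set x]) = (1 / 3)%:E
    & forall (s : seq nat) (B : nat -> set R[i]), uniq s ->
        (forall i, i \in s -> borelC (B i)) ->
        P (\bigcap_(i in [set` s]) (tau i @^-1` B i)) =
        (\prod_(i <- s) P (tau i @^-1` B i))%E].

(* With the index shift, this is sigma(tau_1, ..., tau_t); it is trivial for
   t = 0. *)
Definition generated_filtration {R : realType} {T : Type}
    (tau : nat -> T -> R[i]) (t : nat) : set (set T) :=
  <<s \bigcup_(i in `I_t) preimage_set_system setT (tau i) borelC >>.

(* Y is a version of the conditional expectation of X given G, for X and Y
   integrable real random variables and G a sub-sigma-algebra. *)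
Definition is_cond_exp {R : realType} {d : measure_display}
    {T : measurableType d} (P : probability T R) (G : set (set T))
    (X Y : T -> R) : Prop :=
  [/\ P.-integrable setT (EFin \o X),
      P.-integrable setT (EFin \o Y),
      forall B : set R, measurable B -> G (Y @^-1` B)
    & forall A, G A ->
        (\int[P]_(w in A) (Y w)%:E = \int[P]_(w in A) (X w)%:E)%E].

Definition martingale {R : realType} {d : measure_display}
    {T : measurableType d} (P : probability T R) (F : nat -> set (set T))
    (Z : nat -> T -> R[i]) : Prop :=
  forall t, is_cond_exp P (F t) (fun w => complex.Re (Z t.+1 w))
                            (fun w => complex.Re (Z t w)) /\
            is_cond_exp P (F t) (fun w => complex.Im (Z t.+1 w))
                            (fun w => complex.Im (Z t w)).

Definition adapted {R : realType} {T : Type} (F : nat -> set (set T))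
    (Z : nat -> T -> R[i]) : Prop :=
  forall t B, borelC B -> F t (Z t @^-1` B).

Definition parisian_walk {R : realType} {d : measure_display}
    {T : measurableType d} (P : probability T R) (F : nat -> set (set T))
    (Z : nat -> T -> R[i]) : Prop :=
  [/\ adapted F Z,
      martingale P F Z,
      exists2 z0, eisenstein z0 & forall w, Z 0%N w = z0
    & forall t w, Z t.+1 w - Z t w \in [:: 1; zeta; zeta ^+ 2]].

(* Main.v *)
(* In the coordinates z = a + b zeta, the sets clA1, A2, clA3, A4, clA5, A6 are
   the six cones of linearity of
   max (a - 1 - b, a - 1, b - 1, b - a, - a, - b).
   This function vanishes on {0, 1, 1 + zeta}, changes by at most one along an
   edge, and from every point where it is positive it decreases by one along
   some edge: it is the distance to {0, 1, 1 + zeta}. The identity holds path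
   by path: the Re term is the increment of the linear form of the cone of Z_t,
   and the local time makes up the difference when the step leaves the cone. *)
Require Import Defs.
From HB Require Import structures.
From mathcomp Require Import all_boot all_order all_algebra.
From mathcomp Require Import all_classical all_reals all_analysis.
From mathcomp Require Import complex.
From mathcomp Require Import zify ring lra.
Import Order.TTheory GRing.Theory Num.Theory numFieldNormedType.Exports.
Local Open Scope ring_scope.

(** * Integer coordinates on the Eisenstein lattice *)

Definition eis {R : realType} (a b : int) : R[i] := a%:~R + b%:~R * zeta.

Section Eisenstein.
Context {R : realType}.
Implicit Types (a b c d : int) (z : R[i]) (x : nat -> R[i]).

Lemma zetaE : zeta = (- (1 / 2) +i* (Num.sqrt 3 / 2))%C :> R[i].
Proof.
rewrite /zeta; have -> : (2 : R[i])^-1 = ((2^-1 : R)%:C)%C.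
  by rewrite fmorphV rmorph_nat.
by simpc.
Qed.

Lemma zeta_sqr : zeta ^+ 2 = - 1 - zeta :> R[i].
Proof.
have h3 : Num.sqrt 3 ^+ 2 = 3 :> R by rewrite sqr_sqrtr.
rewrite zetaE expr2; simpc; apply/eqP; rewrite eq_complex /=.
apply/andP; split; apply/eqP; nra.
Qed.

Lemma intr_complex a : a%:~R = (a%:~R +i* 0)%C :> R[i].
Proof. by rewrite -[LHS](rmorph_int (real_complex R)). Qed.

Lemma eisE a b :
  eis a b = ((a%:~R - b%:~R / 2) +i* (b%:~R * Num.sqrt 3 / 2))%C :> R[i].
Proof.
rewrite /eis zetaE !intr_complex; simpc; apply/eqP; rewrite eq_complex /=.
by apply/andP; split; apply/eqP; field.
Qed.

(** The imaginary part determines [b] because [Num.sqrt 3] is nonzero, and the real part then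
    determines [a]. *)
Lemma eis_inj a b c d : eis a b = eis c d :> R[i] -> a = c /\ b = d.
Proof.
rewrite !eisE => -[hre him].
have s3 : Num.sqrt 3 != 0 :> R by rewrite sqrtr_eq0 -ltNge.
have hb : b = d.
  apply/eqP; rewrite -(eqr_int R); apply/eqP.
  by apply: (mulIf s3); lra.
split=> //; apply/eqP; rewrite -(eqr_int R); apply/eqP.
by rewrite hb in hre; lra.
Qed.

Lemma eisD a b c d : eis a b + eis c d = eis (a + c) (b + d) :> R[i].
Proof. rewrite /eis !intrD; ring. Qed.

Lemma eisB a b c d : eis a b - eis c d = eis (a - c) (b - d) :> R[i].
Proof. rewrite /eis !intrD !intrN; ring. Qed.

Lemma eisM a b c d :
  eis a b * eis c d = eis (a * c - b * d) (a * d + b * c - b * d) :> R[i].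
Proof.
rewrite /eis !(intrD, intrN, intrM); apply/eqP; rewrite -subr_eq0; apply/eqP.
(* The two sides differ by a multiple of [1 + zeta + zeta ^+ 2], which vanishes. *)
transitivity (b%:~R * d%:~R * (zeta ^+ 2 + 1 + zeta) : R[i]); first ring.
by rewrite zeta_sqr; ring.
Qed.

Lemma conjc_eis a b : conjc (eis a b) = eis (a - b) (- b) :> R[i].
Proof.
rewrite !eisE /=; apply/eqP; rewrite eq_complex /= !(intrD, intrN).
by apply/andP; split; apply/eqP; field.
Qed.

Lemma intr_eis a : a%:~R = eis a 0 :> R[i].
Proof. by rewrite /eis mul0r addr0. Qed.

Lemma eis0 : 0 = eis 0 0 :> R[i]. Proof. exact: intr_eis 0. Qed.

Lemma eis1 : 1 = eis 1 0 :> R[i]. Proof. exact: intr_eis 1. Qed.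

Lemma zeta_eis : zeta = eis 0 1 :> R[i].
Proof. by rewrite /eis add0r mul1r. Qed.

Lemma zeta_sqr_eis : zeta ^+ 2 = eis (- 1) (- 1) :> R[i].
Proof. by rewrite zeta_sqr /eis !intrN mulN1r. Qed.

Lemma eisN a b : - eis a b = eis (- a) (- b) :> R[i].
Proof. by rewrite /eis !intrN mulNr opprD. Qed.

Definition eis_simp := (eisN, eisM, eisD).

(** Since [(1 - zeta ^+ 2) * zeta = zeta - 1], the basis [1, zeta] contributes real parts [3/2] and
    [- 3/2]. The form [a - b] is the one of [clA1]; multiplying by a cube root of unity, possibly
    after conjugation, yields the linear parts of the other five. *)
Lemma Re_eis a b :
  2 / 3 * complex.Re ((1 - zeta ^+ 2) * eis a b : R[i]) = (a - b)%:~R.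
Proof.
rewrite zeta_sqr_eis eis1 !eis_simp eisE /= !(intrD, intrN, intrM).
by field.
Qed.

(** * The regions as integer inequalities in the coordinates *)

Ltac to_coord :=
  rewrite /= ?intr_eis ?zeta_sqr_eis ?zeta_eis ?eis1 ?eis0 ?eis_simp.
Ltac eis_eq := to_coord; congr eis; lia.
Ltac from_region := to_coord => /eis_inj; lia.

Lemma clA1_eis a b : (eis a b \in (clA1 : set R[i])) = (1 <= a) && (b <= 0).
Proof.
apply/idP/idP; rewrite inE.
  by move=> [[[[k1 [k2 [h]]]|[k [h]]]|[k [h]]]|]; from_region.
(* The two tests separate the apex, the edges [B1] and [B5], and the open cone [A1]. *)
move=> h; have [hb|hb] := eqVneq b 0; have [ha|ha] := eqVneq a 1.
- right; eis_eq.
- left; left; right; exists a; split; first lia; eis_eq.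
- left; right; exists b; split; first lia; eis_eq.
- left; left; left; exists (a - b), (- b); split; first lia; eis_eq.
Qed.

Lemma clA3_eis a b : (eis a b \in (clA3 : set R[i])) = (a <= b) && (b <= 0).
Proof.
apply/idP/idP; rewrite inE.
  by move=> [[[[k1 [k2 [h]]]|[k [h]]]|[k [h]]]|]; from_region.
move=> h; have [hb|hb] := eqVneq b 0; have [ha|ha] := eqVneq a b.
- right; eis_eq.
- left; right; exists a; split; first lia; eis_eq.
- left; left; right; exists (- b); split; first lia; eis_eq.
- left; left; left; exists (- a), (- b); split; first lia; eis_eq.
Qed.

Lemma clA5_eis a b : (eis a b \in (clA5 : set R[i])) = (1 <= a) && (a <= b).
Proof.
apply/idP/idP; rewrite inE.
  by move=> [[[[k1 [k2 [h]]]|[k [h]]]|[k [h]]]|]; from_region.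
move=> h; have [hb|hb] := eqVneq a 1; have [ha|ha] := eqVneq a b.
- right; eis_eq.
- left; left; right; exists (b - 1); split; first lia; eis_eq.
- left; right; exists (- b); split; first lia; eis_eq.
- left; left; left; exists b, (b - a); split; first lia; eis_eq.
Qed.

Lemma A2_eis a b : (eis a b \in (A2 : set R[i])) = (b < a) && (a <= 0).
Proof.
apply/idP/idP; rewrite inE; first by move=> [k1 [k2 [h]]]; from_region.
by move=> h; exists (- b), (- a); split; first lia; eis_eq.
Qed.

Lemma A4_eis a b : (eis a b \in (A4 : set R[i])) = (a <= 0) && (0 < b).
Proof.
apply/idP/idP; rewrite inE; first by move=> [k1 [k2 [h]]]; from_region.
by move=> h; exists (b - a), (- a); split; first lia; eis_eq.
Qed.

Lemma A6_eis a b : (eis a b \in (A6 : set R[i])) = (0 < b) && (b < a).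
Proof.
apply/idP/idP; rewrite inE; first by move=> [k1 [k2 [h]]]; from_region.
by move=> h; exists a, b; split; first lia; eis_eq.
Qed.

Definition region_eis :=
  (clA1_eis, clA3_eis, clA5_eis, A2_eis, A4_eis, A6_eis).

(** * The graph distance in coordinates *)

Definition hex_dist a b : int :=
  Num.max (Num.max (Num.max (a - 1 - b) (a - 1)) (Num.max (b - 1) (b - a)))
          (Num.max (- a) (- b)).

Lemma hex_dist_le a b c : (hex_dist a b <= c) =
  [&& [&& a - 1 - b <= c & a - 1 <= c], b - 1 <= c & b - a <= c] &&
  ((- a <= c) && (- b <= c)).
Proof. by rewrite /hex_dist !ge_max. Qed.

(** The branches belong to [clA1], [clA5], [A6], [A4], [clA3] and [A2], in this order. *)
Lemma hex_dist_cone a b : hex_dist a b =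
  if 1 <= a then if b <= 0 then a - 1 - b else if a <= b then b - 1 else a - 1
  else if 0 < b then b - a else if a <= b then - a else - b.
Proof.
by apply/eqP; rewrite eq_le hex_dist_le; case: ifP => ?; case: ifP => ?;
  try case: ifP => ?; rewrite !le_max; lia.
Qed.

Lemma tri_adj_eis a b c d :
  tri_adj (eis a b) (eis c d : R[i]) = ((a - c, b - d) \in
    [:: (1, 0); (- 1, 0); (0, 1); (0, - 1); (- 1, - 1); (1, 1)]).
Proof.
rewrite /tri_adj eisB zeta_sqr_eis zeta_eis eis1 !eisN !inE.
have e p q r s : (eis p q == eis r s :> R[i]) = ((p, q) == (r, s)).
  by apply/eqP/eqP => [/eis_inj[-> ->]|[-> ->]].
by rewrite !e !(oppr0, opprK).
Qed.

Lemma tri_adj_eis_ex a b z :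
  tri_adj (eis a b) z -> exists c d, z = eis c d.
Proof.
rewrite /tri_adj zeta_sqr_eis zeta_eis eis1 !eisN => h.
have [c [d e]] : exists c d, eis a b - z = eis c d.
  by move: h; rewrite !inE; (repeat case/orP) => /eqP ->; do 2 eexists.
by exists (a - c), (b - d); rewrite -eisB -e subKr.
Qed.

(** Along an edge each of the six linear forms changes by at most one, hence so does their
    maximum. *)
Lemma hex_dist_path a b (p : seq R[i]) : path tri_adj (eis a b) p ->
  exists c d, last (eis a b) p = eis c d /\
              hex_dist c d <= hex_dist a b + (size p)%:Z.
Proof.
elim: p a b => [|z p IH] a b /=; first by exists a, b; split=> //; lia.
move=> /andP[h]; have [c [d e]] := tri_adj_eis_ex _ _ _ h; subst z.
move/IH => [c' [d' [-> h']]]; exists c', d'; split=> //.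
suff: hex_dist c d <= hex_dist a b + 1 by lia.
(* Expanded by [hex_dist_le], this trivial inequality bounds all six forms at [(a, b)]. *)
have := lexx (hex_dist a b); move: h.
by rewrite tri_adj_eis !inE !xpair_eqE !hex_dist_le; lia.
Qed.

Lemma hex_dist_descent a b : 0 < hex_dist a b ->
  exists c d, hex_dist c d = hex_dist a b - 1 /\
              tri_adj (eis c d) (eis a b : R[i]).
Proof.
move=> h.
have step c d : hex_dist c d = hex_dist a b - 1 ->
    (c - a, d - b) \in
      [:: (1, 0); (- 1, 0); (0, 1); (0, - 1); (- 1, - 1); (1, 1)] ->
    exists c d, hex_dist c d = hex_dist a b - 1 /\
                tri_adj (eis c d) (eis a b : R[i]).
  by move=> *; exists c, d; rewrite tri_adj_eis.
rewrite /hex_dist in h step *.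
(* In each cone the chosen neighbour stays in the closed cone and lowers its form by one. The tests
   [a = 1] and [a = b] catch the edges where the generic move would leave it. *)
have [ha|ha] := lerP 1 a; have [hb|hb] := lerP b 0.
- have [?|?] := eqVneq a 1.
    by apply: (step a (b + 1)); rewrite ?inE ?xpair_eqE; lia.
  by apply: (step (a - 1) b); rewrite ?inE ?xpair_eqE; lia.
- have [?|?] := ltP b a.
    by apply: (step (a - 1) b); rewrite ?inE ?xpair_eqE; lia.
  have [?|?] := eqVneq a b.
    by apply: (step (a - 1) (b - 1)); rewrite ?inE ?xpair_eqE; lia.
  by apply: (step a (b - 1)); rewrite ?inE ?xpair_eqE; lia.
- have [?|?] := ltP b a.
    by apply: (step a (b + 1)); rewrite ?inE ?xpair_eqE; lia.
  have [?|?] := eqVneq a b.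
    by apply: (step (a + 1) (b + 1)); rewrite ?inE ?xpair_eqE; lia.
  by apply: (step (a + 1) b); rewrite ?inE ?xpair_eqE; lia.
- by apply: (step a (b - 1)); rewrite ?inE ?xpair_eqE; lia.
Qed.

(** Repeated descent ends at a zero of [hex_dist], that is, in [{0, 1, 1 + zeta}]; read backwards it
    is a path of the required length. *)
Lemma path_lengths_hex_dist n a b :
  hex_dist a b = n%:Z -> path_lengths (eis a b : R[i]) n.
Proof.
elim: n a b => [|n IH] a b h.
  exists (eis a b), [::]; split=> //; rewrite eis1 eis0 zeta_eis eisD !inE.
  have [[-> ->]|[[-> ->]|[-> ->]]] : (a = 0 /\ b = 0) \/ (a = 1 /\ b = 0) \/
      (a = 1 /\ b = 1) by move: h; rewrite /hex_dist; lia.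
  - by rewrite eqxx.
  - by rewrite eqxx orbT.
  - by rewrite eqxx !orbT.
have /hex_dist_descent[c [d [e hadj]]] : 0 < hex_dist a b by rewrite h.
have /IH[x [p [px pp lp sp]]] : hex_dist c d = n%:Z by lia.
exists x, (rcons p (eis a b)); split=> //.
- by rewrite rcons_path pp lp.
- by rewrite last_rcons.
- by rewrite size_rcons sp.
Qed.

(** [hex_dist] vanishes at the three possible starting points and grows by at most one per edge. *)
Lemma hex_dist_le_length n a b :
  path_lengths (eis a b : R[i]) n -> hex_dist a b <= n%:Z.
Proof.
move=> [x [p [+ pp lp <-]]].
have start c d : hex_dist c d = 0 -> x = eis c d ->
    hex_dist a b <= (size p)%:Z.
  move=> h0 xe; rewrite xe in pp lp.
  have [c' [d' []]] := hex_dist_path _ _ _ pp.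
  by rewrite lp => /eis_inj[-> ->]; rewrite h0 add0r.
rewrite !inE => /or3P[] /eqP xe.
- by apply: (start 0 0); rewrite // -eis0.
- by apply: (start 1 0); rewrite // -eis1.
- by apply: (start 1 1); rewrite // xe zeta_eis eis1 eisD.
Qed.

Lemma tri_norm_eis a b : (tri_norm (eis a b : R[i]))%:Z = hex_dist a b.
Proof.
(* The maximum is nonnegative: [a - 1] and [- a] cannot both be negative for an integer [a]. *)
have h : hex_dist a b = `|hex_dist a b|%N%:Z by rewrite /hex_dist; lia.
rewrite h; congr Posz; apply: xget_unique.
  split; first exact: path_lengths_hex_dist.
  by move=> m /hex_dist_le_length; lia.
move=> m [/hex_dist_le_length h1 h2].
by have := h2 _ (path_lengths_hex_dist _ _ _ h); lia.
Qed.

(** * The identity for a single step *)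

Lemma exitsS (A : set R[i]) x t :
  exits A x t.+1 = (exits A x t + ((x t \in A) && (x t.+1 \notin A)))%N.
Proof.
rewrite /exits -!sum1_card big_mkcond big_ord_recr [in RHS]big_mkcond /=.
by congr addn; rewrite inE; case: ifP.
Qed.

Lemma eisenstein_step z z' : eisenstein z ->
  z' - z \in [:: 1; zeta; zeta ^+ 2] -> eisenstein z'.
Proof.
move=> [a [b ->]]; rewrite -/(eis a b) zeta_sqr_eis zeta_eis eis1 !inE.
move=> h; suff [c [d e]] : exists c d, z' = eis c d by exists c, d.
by move: h => /or3P[] /eqP/(canRL (subrK _)) ->; rewrite eisD; do 2 eexists.
Qed.

Lemma tri_norm_step x t : eisenstein (x t) ->
  x t.+1 - x t \in [:: 1; zeta; zeta ^+ 2] ->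
  (tri_norm (x t.+1))%:R - (tri_norm (x t))%:R =
    2 / 3 * complex.Re ((1 - zeta ^+ 2) *
              (phi (x t) * (x t.+1 - x t) +
               psi (x t) * (conjc (x t.+1) - conjc (x t))))
    + (local_time x t.+1)%:R - (local_time x t)%:R :> R.
Proof.
move=> [a [b xt]] hstep.
have [c [d xt']] := eisenstein_step _ _ (ex_intro _ a (ex_intro _ b xt)) hstep.
rewrite -/(eis a b) in xt; rewrite -/(eis c d) in xt'.
rewrite xt xt' /local_time !exitsS xt xt' !region_eis.
set inner := phi _ * _ + _; set u1 := nat_of_bool _; set u3 := nat_of_bool _.
set u5 := nat_of_bool _.
(* By [Re_eis] the real part contributes [p - q], which leaves an identity between integers. *)
suff [p [q [-> e]]] : exists p q, inner = eis p q /\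
    hex_dist c d - hex_dist a b = p - q + u1%:Z + u3%:Z + u5%:Z.
  rewrite Re_eis; have := congr1 (intr : int -> R) e.
  by rewrite -!tri_norm_eis !(intrD, intrN) -!pmulrn !natrD; lra.
have nat_eis (n : nat) : n%:R = eis n 0 :> R[i] by rewrite -intr_eis.
rewrite /inner /phi /psi !indicE !region_eis zeta_sqr_eis !nat_eis !conjc_eis.
rewrite zeta_eis !(eisB, eisM, eisD).
do 2 eexists; split; first by [].
move: hstep; rewrite xt xt' zeta_sqr_eis zeta_eis eis1 eisB !inE /u1 /u3 /u5.
have -> : (a <= 0) = ~~ (1 <= a) by lia.
rewrite (hex_dist_cone a b) => /or3P hstep.
have {}hstep : [\/ c - a = 1 /\ d - b = 0, c - a = 0 /\ d - b = 1 |
    c - a = - 1 /\ d - b = - 1].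
  by case: hstep => /eqP/eis_inj; [constructor 1|constructor 2|constructor 3].
(* Once the cone of [(a, b)] is fixed, exactly one indicator in [phi] and [psi] is nonzero. A step
   out of [A2], [A4] or [A6] only reaches the boundary of the cone, where neighbouring forms agree;
   a step out of a closed cone [clA1], [clA3] or [clA5] makes the distance exceed the old form by
   one, which is the exit counted by [u1], [u3] or [u5]. *)
by case: (lerP 1 a) => ha; case: (lerP b 0) => hb; case: (lerP a b) => hab;
  rewrite /=; try (exfalso; lia);
  rewrite /hex_dist; case: hstep => -[ec ed]; rewrite ?ec ?ed; lia.
Qed.
End Eisenstein.

Theorem proposition2 (R : realType) (d : measure_display)
    (Omega : measurableType d) (P : probability Omega R)
    (tau Z : nat -> Omega -> R[i]) :
  iid_cube_roots P tau ->
  parisian_walk P (generated_filtration tau) Z ->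
  forall (t : nat) (w : Omega),
    (tri_norm (Z t.+1 w))%:R - (tri_norm (Z t w))%:R =
    2 / 3 * complex.Re ((1 - zeta ^+ 2) *
              (phi (Z t w) * (Z t.+1 w - Z t w) +
               psi (Z t w) * (conjc (Z t.+1 w) - conjc (Z t w))))
    + (local_time (Z^~ w) t.+1)%:R - (local_time (Z^~ w) t)%:R :> R.
Proof.
move=> _ [_ _ [z0 hz0 Z0] step] t w.
have lattice s : eisenstein (Z s w).
  elim: s => [|s IH]; first by rewrite Z0.
  exact: eisenstein_step IH (step s w).
exact: (tri_norm_step (Z^~ w)) (lattice t) (step t w).
Qed.
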